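(* Let $(M;\rho)$ be an admissible representation of a Leibniz pair $(A,\mathcal S,[\cdot,\cdot]_{\mathcal S},\beta)$. Define $\overline\rho:\mathcal S\otimes_{\mathbb K}A\to\mathfrak{gl}_{\mathbb K}(M)$ by $\overline\rho(x\otimes a)=a\rho(x)$ for all $x\in\mathcal S$, $a\in A$. Then $(M;\overline\rho)$ is a representation of the action Lie-Rinehart algebra $(A,\mathcal S\otimes_{\mathbb K}A,[\cdot,\cdot],\alpha)$.
   Context: All vector spaces are over an algebraically closed field $\mathbb K$ of characteristic $0$; $A$ is a commutative associative $\mathbb K$-algebra and $\mathrm{Der}_{\mathbb K}(A)$ is its Lie algebra of $\mathbb K$-linear derivations. A Leibniz pair $(A,\mathcal S,[\cdot,\cdot]_{\mathcal S},\beta)$ is a $\mathbb K$-Lie algebra $\mathcal S$ with a $\mathbb K$-Lie algebra homomorphism $\beta:\mathcal S\to\mathrm{Der}_{\mathbb K}(A)$. An admissible representation $(M;\rho)$ is an $A$-module $M$ with a $\mathbb K$-Lie algebra homomorphism $\rho:\mathcal S\to\mathfrak{gl}_{\mathbb K}(M)$ such that $\rho(x)(am)=a\rho(x)m+\beta(x)(a)m$ for $x\in\mathcal S,a\in A,m\in M$. A Lie-Rinehart algebra $(A,\mathcal L,[\cdot,\cdot],\alpha)$ is a $\mathbb K$-Lie algebra $\mathcal L$ with an $A$-module structure and a map $\alpha:\mathcal L\to\mathrm{Der}_{\mathbb K}(A)$ that is a $\mathbb K$-Lie algebra and $A$-module homomorphism, with $[x,ay]=a[x,y]+\alpha(x)(a)y$.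 A representation $(M;\rho)$ of $\mathcal L$ is an $A$-module $M$ with an $A$-linear $\mathbb K$-Lie algebra homomorphism $\rho:\mathcal L\to\mathfrak{gl}_{\mathbb K}(M)$ (so $\rho(ax)=a\rho(x)$) such that $\rho(x)(am)=a\rho(x)m+\alpha(x)(a)m$. The action Lie-Rinehart algebra of a Leibniz pair is $\mathcal S\otimes_{\mathbb K}A$ with $a(x\otimes b)=x\otimes ab$, $[x\otimes a,y\otimes b]=[x,y]_{\mathcal S}\otimes ab+y\otimes(a\beta(x)b)-x\otimes(b\beta(y)a)$ and $\alpha(x\otimes a)=a\beta(x)$. *)

(* Defs.v *)
From HB Require Import structures.
From mathcomp Require Import all_boot all_order all_algebra.
From mathcomp Require Import boolp classical_sets functions.
From mathcomp Require Import ring.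

Set Implicit Arguments.
Unset Strict Implicit.
Unset Printing Implicit Defensive.

Import GRing.Theory.
Local Open Scope ring_scope.

(* An A-module M, viewed as a K-vector space along K -> A, k |-> k%:A.  A      *)
(* separate carrier is needed because a type has at most one canonical        *)
(* scalar action.                                                             *)
Definition restr (K : fieldType) (A : comAlgType K) (M : lmodType A) : Type := M.

Section RestrictionOfScalars.
Variables (K : fieldType) (A : comAlgType K) (M : lmodType A).

HB.instance Definition _ := GRing.Zmodule.copy (restr M) M.

Definition restr_scale (k : K) (m : restr M) : restr M := k%:A *: (m : M).

Fact restr_scaleA a b m : restr_scale a (restr_scale b m) = restr_scale (a * b) m.
Proof. by rewrite /restr_scale scalerA -scalerAl mul1r scalerA. Qed.
Fact restr_scale1 : left_id 1 restr_scale.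
Proof. by move=> m; rewrite /restr_scale scale1r scale1r. Qed.
Fact restr_scaleDr : right_distributive restr_scale +%R.
Proof. by move=> k u v; apply: (@scalerDr A M). Qed.
Fact restr_scaleDl m : {morph restr_scale^~ m : a b / a + b}.
Proof. by move=> a b; rewrite /restr_scale scalerDl (@scalerDl A M). Qed.

HB.instance Definition _ := GRing.Zmodule_isLmodule.Build K (restr M)
  restr_scaleA restr_scale1 restr_scaleDr restr_scaleDl.

Lemma restr_scaleE (k : K) (m : restr M) : k *: m = (k%:A *: (m : M) : M).
Proof. by []. Qed.

End RestrictionOfScalars.

Record is_lie_bracket (K : fieldType) (L : lmodType K) (br : L -> L -> L) : Prop :=
  IsLieBracket {
    lie_linearl : forall y, linear (br^~ y);
    lie_linearr : forall x, linear (br x);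
    lie_alt : forall x, br x x = 0;
    lie_jacobi : forall x y z,
      br x (br y z) + br y (br z x) + br z (br x y) = 0
  }.

Record lieAlg (K : fieldType) := LieAlg {
  lie_sort :> lmodType K;
  lie : lie_sort -> lie_sort -> lie_sort;
  lieP : is_lie_bracket lie
}.
Arguments lie {K l}.

Record is_lie_hom (K : fieldType) (L L' : lieAlg K) (f : L -> L') : Prop :=
  IsLieHom {
    lie_hom_linear : linear f;
    lie_homE : forall x y, f (lie x y) = lie (f x) (f y)
  }.

Section LieTheory.
Variables (K : fieldType) (L : lieAlg K).
Implicit Types x y z : L.

Lemma lieDl x x' y : lie (x + x') y = lie x y + lie x' y.
Proof. by have := lie_linearl (lieP L) y 1 x x'; rewrite /= !scale1r. Qed.
Lemma lieDr x y y' : lie x (y + y') = lie x y + lie x y'.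
Proof. by have := lie_linearr (lieP L) x 1 y y'; rewrite /= !scale1r. Qed.
Lemma lie0l y : lie (0 : L) y = 0.
Proof. by apply: (addrI (lie 0 y)); rewrite -lieDl !addr0. Qed.
Lemma lie0r x : lie x (0 : L) = 0.
Proof. by apply: (addrI (lie x 0)); rewrite -lieDr !addr0. Qed.
Lemma lieZl (k : K) x y : lie (k *: x) y = k *: lie x y.
Proof.
by have := lie_linearl (lieP L) y k x 0; rewrite /= !addr0 lie0l addr0.
Qed.
Lemma lieZr (k : K) x y : lie x (k *: y) = k *: lie x y.
Proof.
by have := lie_linearr (lieP L) x k y 0; rewrite /= !addr0 lie0r addr0.
Qed.
Lemma lieN x y : lie x y = - lie y x.
Proof.
apply/eqP; rewrite -addr_eq0; apply/eqP.
have := lie_alt (lieP L) (x + y).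
by rewrite lieDl !lieDr !(lie_alt (lieP L)) addr0 add0r.
Qed.

End LieTheory.

Section LieHomTheory.
Variables (K : fieldType) (L L' : lieAlg K) (f : L -> L').
Hypothesis f_hom : is_lie_hom f.

Lemma lie_homD x y : f (x + y) = f x + f y.
Proof. by have := lie_hom_linear f_hom 1 x y; rewrite !scale1r. Qed.
Lemma lie_hom0 : f 0 = 0.
Proof. by apply: (addrI (f 0)); rewrite -lie_homD !addr0. Qed.
Lemma lie_homZ (k : K) x : f (k *: x) = k *: f x.
Proof. by have := lie_hom_linear f_hom k x 0; rewrite !addr0 lie_hom0 addr0. Qed.

End LieHomTheory.

(* The commutator bracket on an additive subgroup L of functions V -> V.      *)
Section Commutator.
Variables (V L : zmodType) (app : L -> V -> V).
Hypothesis appD : forall f, {morph app f : u v / u + v}.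
Hypothesis appDl : forall f g v, app (f + g) v = app f v + app g v.
Hypothesis app_inj : forall f g, app f =1 app g -> f = g.
Variable br : L -> L -> L.
Hypothesis brE : forall f g v, app (br f g) v = app f (app g v) - app g (app f v).

Let app0l v : app 0 v = 0.
Proof. by apply: (addrI (app 0 v)); rewrite -appDl !addr0. Qed.
Let app0 f : app f 0 = 0.
Proof. by apply: (addrI (app f 0)); rewrite -appD !addr0. Qed.
Let appN f v : app f (- v) = - app f v.
Proof. by apply/eqP; rewrite -addr_eq0 -appD addNr app0. Qed.

Lemma commutator_alt f : br f f = 0.
Proof. by apply: app_inj => v; rewrite brE subrr app0l. Qed.

Lemma commutator_jacobi f g h : br f (br g h) + br g (br h f) + br h (br f g) = 0.
Proof.
apply: app_inj => v; rewrite !appDl app0l !brE !appD !appN !opprD !opprK !addrA.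
rewrite [LHS](ACl ((1*11)*(8*2)*(5*3)*(4*10)*(12*6)*(9*7)))%AC /=.
by rewrite !subrr !addr0.
Qed.
End Commutator.

Section Derivations.
Variables (K : fieldType) (A : comAlgType K).

Definition is_derivation (D : A -> A) : Prop :=
  linear D /\ forall a b, D (a * b) = a * D b + b * D a.

Definition derivation_pred : {pred (A -> A^o)} :=
  fun D => `[< is_derivation (D : A -> A) >].

(* Der_K(A); values are typed in A^o so that Der A inherits the A-module      *)
(* structure (a D)(b) = a D(b).                                               *)
Record Der : Type := MkDer {
  der_fun :> A -> A^o;
  der_funP : der_fun \in derivation_pred
}.

HB.instance Definition _ := [isSub for der_fun].
HB.instance Definition _ := [Choice of Der by <:].

Fact derivation_closed : submod_closed derivation_pred.
Proof.
split=> [|a D E].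
  apply/asboolP; split=> [k u v|u v] /=; last by rewrite !mulr0 addr0.
  by rewrite scaler0 addr0.
move=> /asboolP[Dl DM] /asboolP[El EM]; apply/asboolP; split=> [k u v|u v].
  change (a * D (k *: u + v) + E (k *: u + v) =
          k *: (a * D u + E u) + (a * D v + E v)).
  by rewrite Dl El mulrDr -scalerAr scalerDr addrACA.
change (a * D (u * v) + E (u * v) =
        u * (a * D v + E v) + v * (a * D u + E u)).
by rewrite DM EM !mulrDr !(mulrCA a) addrACA.
Qed.

HB.instance Definition _ := GRing.isSubmodClosed.Build A (A -> A^o)
  derivation_pred derivation_closed.
HB.instance Definition _ := [SubChoice_isSubLmodule of Der by <:].

Implicit Types (D E : Der) (a b : A).

Lemma derP D : is_derivation (D : A -> A).
Proof. by have /asboolP := der_funP D. Qed.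

Lemma der_eq D E : (D : A -> A) =1 E -> D = E.
Proof. by move=> DE; apply/val_inj/funext. Qed.

Lemma derDl D E b : (D + E) b = (D b : A) + E b. Proof. by []. Qed.
Lemma derZl a D b : (a *: D) b = a * D b. Proof. by []. Qed.
Lemma derM D a b : D (a * b) = a * D b + b * D a :> A.
Proof. by have [_] := derP D. Qed.
Lemma derD D : {morph (D : A -> A) : a b / a + b}.
Proof.
by move=> a b; have [/(_ 1 a b)] := derP D; rewrite !scale1r.
Qed.
Lemma derZ D (k : K) b : D (k *: b) = k *: (D b : A) :> A.
Proof.
have D0 : D 0 = 0 :> A by apply: (addrI (D 0 : A)); rewrite -derD !addr0.
by have [/(_ k b 0)] := derP D; rewrite D0 !addr0.
Qed.

Fact der_commutator_subproof D E :
  (fun b : A => (D (E b) - E (D b) : A)) \in derivation_pred.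
Proof.
apply/asboolP; split=> [k u v|u v].
  rewrite !(derD, derZ) scalerBr opprD addrACA.
  by [].
rewrite !(derD, derM) !mulrBr !opprD !addrA.
rewrite [LHS](ACl (1*5*3*7*(2*8)*(4*6)))%AC /=.
by rewrite [E v * _]mulrC [E u * _]mulrC !subrr !addr0.
Qed.
Definition der_commutator D E : Der := MkDer (der_commutator_subproof D E).

Lemma der_commutatorE D E b : der_commutator D E b = (D (E b) - E (D b) : A).
Proof. by []. Qed.

Fact der_lie_bracket :
  @is_lie_bracket K (restr Der) (der_commutator : restr Der -> restr Der -> restr Der).
Proof.
split=> [E k D D'|D k E E'|D|D E F].
- apply: der_eq => b.
  change ((k%:A * D (E b) + D' (E b)) - E (k%:A * D b + D' b) =
    k%:A * (D (E b) - E (D b)) + (D' (E b) - E (D' b)) :> A).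
  by rewrite -!scalerAl !mul1r derD derZ scalerBr opprD addrACA.
- apply: der_eq => b.
  change (D (k%:A * E b + E' b) - (k%:A * E (D b) + E' (D b)) =
    k%:A * (D (E b) - E (D b)) + (D (E' b) - E' (D b)) :> A).
  by rewrite -!scalerAl !mul1r derD derZ scalerBr opprD addrACA.
- by apply: (commutator_alt (app := fun D (b : A) => D b)) => //; exact: der_eq.
apply: (commutator_jacobi (app := fun D (b : A) => D b)) => //.
- exact: derD.
- exact: der_eq.
Qed.

Definition der_lie : lieAlg K := LieAlg der_lie_bracket.

End Derivations.

Section GeneralLinear.
Variables (K : fieldType) (A : comAlgType K) (M : lmodType A).

Definition gl_pred : {pred (M -> M)} :=
  fun f => `[< linear (f : restr M -> restr M) >].

(* gl_K(M); it is an A-module through (a f)(m) = a f(m).                      *)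
Record gl : Type := MkGl {
  gl_fun :> M -> M;
  gl_funP : gl_fun \in gl_pred
}.

HB.instance Definition _ := [isSub for gl_fun].
HB.instance Definition _ := [Choice of gl by <:].

Fact gl_closed : submod_closed gl_pred.
Proof.
split=> [|a f g]; first by apply/asboolP => k u v; rewrite scaler0 addr0.
move=> /asboolP fl /asboolP gl; apply/asboolP => k u v.
change (a *: f ((k%:A : A) *: (u : M) + (v : M)) + g ((k%:A : A) *: (u : M) + (v : M)) =
   (k%:A : A) *: (a *: f u + g u) + (a *: f v + g v) :> M).
have -> := fl k u v; have -> := gl k u v; rewrite !restr_scaleE.
by rewrite !(@scalerDr A M) !(@scalerA A M) (mulrC a) addrACA.
Qed.

HB.instance Definition _ := GRing.isSubmodClosed.Build A (M -> M)
  gl_pred gl_closed.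
HB.instance Definition _ := [SubChoice_isSubLmodule of gl by <:].

Implicit Types (f g : gl) (a : A) (m : M).

Lemma gl_linear f : linear (f : restr M -> restr M).
Proof. by have /asboolP := gl_funP f. Qed.
Lemma gl_eq f g : (f : M -> M) =1 g -> f = g.
Proof. by move=> fg; apply/val_inj/funext. Qed.
Lemma glDl f g m : (f + g) m = f m + g m. Proof. by []. Qed.
Lemma glZl a f m : (a *: f) m = a *: f m. Proof. by []. Qed.
Lemma glD f : {morph f : u v / u + v}.
Proof. by move=> u v; have := gl_linear f 1 u v; rewrite !scale1r. Qed.
Lemma glZ f (k : K) m : f (k%:A *: m) = k%:A *: f m.
Proof.
have f0 : f 0 = 0 by apply: (addrI (f 0)); rewrite -glD !addr0.
have := gl_linear f k m 0.
by rewrite !restr_scaleE f0 (@addr0 M) (@addr0 M).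
Qed.

Fact gl_commutator_subproof f g : (fun m => f (g m) - g (f m)) \in gl_pred.
Proof.
apply/asboolP=> k u v; rewrite restr_scaleE.
by rewrite !(glD, glZ) opprD addrACA -(@scalerBr A M).
Qed.
Definition gl_commutator f g : gl := MkGl (gl_commutator_subproof f g).

Fact gl_lie_bracket :
  @is_lie_bracket K (restr gl) (gl_commutator : restr gl -> restr gl -> restr gl).
Proof.
split=> [g k f f'|f k g g'|f|f g h].
- apply: gl_eq => m.
  change ((k%:A *: f (g m) + f' (g m)) - g (k%:A *: f m + f' m) =
    k%:A *: (f (g m) - g (f m)) + (f' (g m) - g (f' m)) :> M).
  by rewrite glD glZ (@scalerBr A M) opprD addrACA.
- apply: gl_eq => m.
  change (f (k%:A *: g m + g' m) - (k%:A *: g (f m) + g' (f m)) =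
    k%:A *: (f (g m) - g (f m)) + (f (g' m) - g' (f m)) :> M).
  by rewrite glD glZ (@scalerBr A M) opprD addrACA.
- by apply: (commutator_alt (app := fun f (m : M) => f m)) => //; exact: gl_eq.
apply: (commutator_jacobi (app := fun f (m : M) => f m)) => //.
- exact: glD.
- exact: gl_eq.
Qed.

Definition gl_lie : lieAlg K := LieAlg gl_lie_bracket.

End GeneralLinear.

Section Tensor.
Variables (K : fieldType) (U V : lmodType K).

(* U (x)_K V by generators and relations: the free commutative monoid on      *)
(* U x V modulo biadditivity and K-balancedness.  A formal sum of pure        *)
(* tensors is a list of pairs.                                                *)
Inductive tensor_rel : seq (U * V) -> seq (U * V) -> Prop :=
| TensorRefl s : tensor_rel s s
| TensorSym s t : tensor_rel s t -> tensor_rel t s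
| TensorTrans s t r : tensor_rel s t -> tensor_rel t r -> tensor_rel s r
| TensorCat s s' t t' :
    tensor_rel s s' -> tensor_rel t t' -> tensor_rel (s ++ t) (s' ++ t')
| TensorC s t : tensor_rel (s ++ t) (t ++ s)
| Tensor0l v : tensor_rel [:: (0, v)] [::]
| Tensor0r u : tensor_rel [:: (u, 0)] [::]
| TensorDl u u' v : tensor_rel [:: (u + u', v)] [:: (u, v); (u', v)]
| TensorDr u v v' : tensor_rel [:: (u, v + v')] [:: (u, v); (u, v')]
| TensorZ (k : K) u v : tensor_rel [:: (k *: u, v)] [:: (u, k *: v)].

Definition tensor_relb : rel (seq (U * V)) := fun s t => `[< tensor_rel s t >].

Fact tensor_relb_refl : reflexive tensor_relb.
Proof. by move=> s; apply/asboolP; constructor. Qed.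
Fact tensor_relb_sym : symmetric tensor_relb.
Proof. by move=> s t; apply/asboolP/asboolP; apply: TensorSym. Qed.
Fact tensor_relb_trans : transitive tensor_relb.
Proof.
by move=> t s r /asboolP st /asboolP tr; apply/asboolP; exact: TensorTrans tr.
Qed.

Canonical tensor_equiv :=
  EquivRel tensor_relb tensor_relb_refl tensor_relb_sym tensor_relb_trans.

Definition tensor : Type := {eq_quot tensor_relb}%qT.
HB.instance Definition _ := Choice.on tensor.

Definition tensor_of (s : seq (U * V)) : tensor := (\pi_{eq_quot tensor_relb} s)%qT.
Definition tens (u : U) (v : V) : tensor := tensor_of [:: (u, v)].

Let rp (t : tensor) : seq (U * V) := repr (t : {eq_quot tensor_relb}%qT).

Lemma tensor_ofP s t : tensor_of s = tensor_of t <-> tensor_rel s t.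
Proof. by split=> [/eqquotP /asboolP|st]; last exact/eqquotP/asboolP. Qed.

Lemma reprKT t : tensor_of (rp t) = t.
Proof. exact: reprK. Qed.

Lemma tensor_repr s : tensor_rel (rp (tensor_of s)) s.
Proof. by apply/tensor_ofP; rewrite reprKT. Qed.

Definition tensor_add (s t : tensor) : tensor := tensor_of (rp s ++ rp t).
Definition tensor_scale (k : K) (t : tensor) : tensor :=
  tensor_of [seq (k *: p.1, p.2) | p <- rp t].

Fact tensor_addE s t : tensor_add (tensor_of s) (tensor_of t) = tensor_of (s ++ t).
Proof. by apply/tensor_ofP/TensorCat; exact: tensor_repr. Qed.

Fact tensor_scale_rel k s t : tensor_rel s t ->
  tensor_rel [seq (k *: p.1, p.2) | p <- s] [seq (k *: p.1, p.2) | p <- t].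
Proof.
elim=> {s t} [s|s t _|s t r _ st _ tr|s s' t t' _ IHs _ IHt|s t|v|u|u u' v|u v v'|l u v] /=.
- exact: TensorRefl.
- exact: TensorSym.
- exact: TensorTrans tr.
- by rewrite !map_cat; exact: TensorCat.
- by rewrite !map_cat; exact: TensorC.
- by rewrite scaler0; exact: Tensor0l.
- exact: Tensor0r.
- by rewrite scalerDr; exact: TensorDl.
- exact: TensorDr.
by rewrite scalerA mulrC -scalerA; exact: TensorZ.
Qed.

Fact tensor_scaleE k s :
  tensor_scale k (tensor_of s) = tensor_of [seq (k *: p.1, p.2) | p <- s].
Proof. by apply/tensor_ofP/tensor_scale_rel/tensor_repr. Qed.

Fact tensor_addA : associative tensor_add.
Proof.
move=> s t r; rewrite -(reprKT s) -(reprKT t) -(reprKT r).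
by rewrite !tensor_addE catA.
Qed.
Fact tensor_addC : commutative tensor_add.
Proof.
move=> s t; rewrite -(reprKT s) -(reprKT t) !tensor_addE.
by apply/tensor_ofP/TensorC.
Qed.
Fact tensor_add0 : left_id (tensor_of [::]) tensor_add.
Proof. by move=> s; rewrite -(reprKT s) tensor_addE. Qed.

Fact tensor_scaleDl_cat k l s : tensor_rel [seq ((k + l) *: p.1, p.2) | p <- s]
  ([seq (k *: p.1, p.2) | p <- s] ++ [seq (l *: p.1, p.2) | p <- s]).
Proof.
apply/tensor_ofP; elim: s => [|[u v] s IHs] //=.
have consE p r : tensor_of (p :: r) = tensor_add (tensor_of [:: p]) (tensor_of r).
  by rewrite tensor_addE.
rewrite consE IHs -cat_cons -!tensor_addE (consE (k *: u, v)) (consE (l *: u, v)).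
have -> : tensor_of [:: ((k + l) *: u, v)] =
    tensor_add (tensor_of [:: (k *: u, v)]) (tensor_of [:: (l *: u, v)]).
  by rewrite tensor_addE scalerDl; apply/tensor_ofP/TensorDl.
rewrite -!tensor_addA; congr tensor_add; rewrite !tensor_addA.
by congr tensor_add; exact: tensor_addC.
Qed.

Fact tensor_addN :
  left_inverse (tensor_of [::]) (tensor_scale (- 1)) tensor_add.
Proof.
move=> s; rewrite -(reprKT s) tensor_scaleE tensor_addE; apply/tensor_ofP.
have := tensor_scaleDl_cat (-1) 1 (rp s); rewrite addNr => /TensorSym.
rewrite (@eq_map _ _ (fun p => (1 *: p.1, p.2)) id); last first.
  by case=> u v; rewrite scale1r.
rewrite map_id => /TensorTrans; apply; elim: (rp s) => [|p t IHt] /=.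
  exact: TensorRefl.
by rewrite scale0r -cat1s -[[::]]cat0s; apply: TensorCat => //; exact: Tensor0l.
Qed.

HB.instance Definition _ := GRing.isZmodule.Build tensor
  tensor_addA tensor_addC tensor_add0 tensor_addN.

Fact tensor_scaleA k l t : tensor_scale k (tensor_scale l t) = tensor_scale (k * l) t.
Proof.
rewrite -(reprKT t) !tensor_scaleE -map_comp; congr tensor_of.
by apply: eq_map => p /=; rewrite scalerA.
Qed.
Fact tensor_scale1 : left_id 1 tensor_scale.
Proof.
move=> t; rewrite -(reprKT t) tensor_scaleE; congr tensor_of.
by rewrite -[RHS]map_id; apply: eq_map => -[u v]; rewrite scale1r.
Qed.
Fact tensor_scaleDr : right_distributive tensor_scale +%R.
Proof.
move=> k s t; rewrite -(reprKT s) -(reprKT t).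
by rewrite [_ + _]tensor_addE !tensor_scaleE map_cat -tensor_addE.
Qed.
Fact tensor_scaleDl t : {morph tensor_scale^~ t : k l / k + l}.
Proof.
move=> k l; rewrite -(reprKT t) /= !tensor_scaleE [RHS]tensor_addE.
exact/tensor_ofP/tensor_scaleDl_cat.
Qed.

HB.instance Definition _ := GRing.Zmodule_isLmodule.Build K tensor
  tensor_scaleA tensor_scale1 tensor_scaleDr tensor_scaleDl.

Lemma tensDl u u' v : tens (u + u') v = tens u v + tens u' v.
Proof. by rewrite [RHS]tensor_addE; apply/tensor_ofP/TensorDl. Qed.
Lemma tensDr u v v' : tens u (v + v') = tens u v + tens u v'.
Proof. by rewrite [RHS]tensor_addE; apply/tensor_ofP/TensorDr. Qed.
Lemma tensZl (k : K) u v : tens (k *: u) v = k *: tens u v.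
Proof. by rewrite [RHS]tensor_scaleE. Qed.
Lemma tensZr (k : K) u v : tens u (k *: v) = k *: tens u v.
Proof. by rewrite -tensZl; apply/esym/tensor_ofP/TensorZ. Qed.
Lemma tens0l v : tens 0 v = 0.
Proof. exact/tensor_ofP/Tensor0l. Qed.
Lemma tens0r u : tens u 0 = 0.
Proof. exact/tensor_ofP/Tensor0r. Qed.
Lemma tensNl u v : tens (- u) v = - tens u v.
Proof. by rewrite -scaleN1r tensZl scaleN1r. Qed.
Lemma tensNr u v : tens u (- v) = - tens u v.
Proof. by rewrite -scaleN1r tensZr scaleN1r. Qed.

Lemma tensor_ofE s : tensor_of s = \sum_(p <- s) tens p.1 p.2.
Proof.
elim: s => [|[u v] s IHs]; first by rewrite big_nil.
by rewrite big_cons -IHs [RHS]tensor_addE.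
Qed.

Lemma tens_ind (P : tensor -> Prop) :
  (forall u v, P (tens u v)) -> (forall s t, P s -> P t -> P (s + t)) ->
  forall t, P t.
Proof.
move=> Pt PD t; rewrite -(reprKT t) tensor_ofE.
by elim/big_rec: _ => [|p s _ Ps]; [rewrite -(tens0l 0) | apply: PD].
Qed.

Record balanced (W : zmodType) (f : U -> V -> W) : Prop := Balanced {
  balancedDl : forall v, {morph f^~ v : u u' / u + u'};
  balancedDr : forall u, {morph f u : v v' / v + v'};
  balancedZ : forall (k : K) u v, f (k *: u) v = f u (k *: v)
}.

(* Meaningful only when f is balanced.                                        *)
Definition tensor_lift (W : zmodType) (f : U -> V -> W) (t : tensor) : W :=
  \sum_(p <- rp t) f p.1 p.2.

Section Lift.
Variables (W : zmodType) (f : U -> V -> W).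
Hypothesis fP : balanced f.

Fact lift_rel s t : tensor_rel s t ->
  \sum_(p <- s) f p.1 p.2 = \sum_(p <- t) f p.1 p.2.
Proof.
have f0l v : f 0 v = 0.
  by apply: (addrI (f 0 v)); rewrite -(balancedDl fP) !addr0.
have f0r u : f u 0 = 0.
  by apply: (addrI (f u 0)); rewrite -(balancedDr fP) !addr0.
elim=> {s t} [s|s t _|s t r _ st _ tr|s s' t t' _ IHs _ IHt|s t|v|u|u u' v|u v v'|l u v].
- by [].
- by move->.
- by rewrite st.
- by rewrite !big_cat IHs IHt.
- by rewrite !big_cat /= addrC.
- by rewrite big_seq1 big_nil f0l.
- by rewrite big_seq1 big_nil f0r.
- by rewrite !big_cons !big_nil /= !addr0 (balancedDl fP).
- by rewrite !big_cons !big_nil /= !addr0 (balancedDr fP).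
by rewrite !big_seq1 (balancedZ fP).
Qed.

Lemma tensor_liftE u v : tensor_lift f (tens u v) = f u v.
Proof. by rewrite /tensor_lift (lift_rel (tensor_repr _)) big_seq1. Qed.

Lemma tensor_liftD : {morph tensor_lift f : s t / s + t}.
Proof.
by move=> s t; rewrite /tensor_lift (lift_rel (tensor_repr _)) big_cat.
Qed.

End Lift.

Lemma tensor_universal (W : lmodType K) (f : U -> V -> W) :
  (forall v, linear (f^~ v)) -> (forall u, linear (f u)) ->
  exists! h : tensor -> W, linear h /\ forall u v, h (tens u v) = f u v.
Proof.
move=> fl fr.
have fP : balanced f.
  have f0l v : f 0 v = 0.
    by apply: (addrI (f 0 v)); have := fl v 1 0 0; rewrite /= !scale1r !addr0.
  have f0r u : f u 0 = 0.
    by apply: (addrI (f u 0)); have := fr u 1 0 0; rewrite /= !scale1r !addr0.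
  split=> [v u u'|u v v'|k u v].
  - by have := fl v 1 u u'; rewrite /= !scale1r.
  - by have := fr u 1 v v'; rewrite /= !scale1r.
  have := fl v k u 0; have := fr u k v 0; rewrite /= !addr0 f0r f0l !addr0.
  by move=> -> ->.
exists (tensor_lift f); split=> [|h [hl hE]].
  split=> [k s t|u v]; last exact: tensor_liftE.
  rewrite (tensor_liftD fP); congr (_ + _).
  elim/tens_ind: s => [u v|s s' IHs IHs']; last first.
    by rewrite scalerDr !(tensor_liftD fP) IHs IHs' scalerDr.
  rewrite -tensZl !(tensor_liftE fP).
  have := fl v k u 0; have := fl v 1 0 0; rewrite /= !scale1r !addr0.
  by move=> /esym/(canRL (addrK _)); rewrite subrr => ->; rewrite addr0.
apply/funext=> t; elim/tens_ind: t => [u v|s t IHs IHt].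
  by rewrite tensor_liftE ?hE.
by rewrite (tensor_liftD fP) IHs IHt; have := hl 1 s t; rewrite !scale1r.
Qed.

End Tensor.

(* beta is typed in Der A; restr (Der A), the carrier of der_lie A, is the    *)
(* same type.                                                                 *)
Record leibnizPair (K : fieldType) (A : comAlgType K) := LeibnizPair {
  lp_lie : lieAlg K;
  lp_beta : lp_lie -> Der A;
  lp_betaP : is_lie_hom (lp_beta : lp_lie -> der_lie A)
}.

Record lieRinehart (K : fieldType) (A : comAlgType K) := LieRinehart {
  lr_mod :> lmodType A;
  lr_bracket : lr_mod -> lr_mod -> lr_mod;
  lr_bracketP : @is_lie_bracket K (restr lr_mod) lr_bracket;
  lr_anchor : lr_mod -> Der A;
  lr_anchor_linear : linear lr_anchor;
  lr_anchor_hom :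
    is_lie_hom (lr_anchor : LieAlg lr_bracketP -> der_lie A);
  lr_leibniz : forall (x : lr_mod) (a : A) (y : lr_mod),
    lr_bracket x (a *: y) = a *: lr_bracket x y + (lr_anchor x a : A) *: y
}.

Definition lr_lie (K : fieldType) (A : comAlgType K) (L : lieRinehart A) :
  lieAlg K := LieAlg (lr_bracketP L).

Record admissible_rep (K : fieldType) (A : comAlgType K) (P : leibnizPair A)
    (M : lmodType A) (rho : lp_lie P -> gl M) : Prop := AdmissibleRep {
  admissible_hom : is_lie_hom (rho : lp_lie P -> gl_lie M);
  admissible_leibniz : forall (x : lp_lie P) (a : A) (m : M),
    rho x (a *: m) = a *: rho x m + (lp_beta x a : A) *: m
}.

Record lr_rep (K : fieldType) (A : comAlgType K) (L : lieRinehart A)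
    (M : lmodType A) (rho : L -> gl M) : Prop := LRRep {
  lr_rep_linear : linear rho;
  lr_rep_hom : is_lie_hom (rho : lr_lie L -> gl_lie M);
  lr_rep_leibniz : forall (x : L) (a : A) (m : M),
    rho x (a *: m) = a *: rho x m + (lr_anchor x a : A) *: m
}.

(* S (x)_K A with the A-action a (x (x) b) = x (x) ab.                        *)
Definition scalar_ext (K : fieldType) (A : comAlgType K) (S : lmodType K) : Type :=
  tensor S A.

Section ScalarExtension.
Variables (K : fieldType) (A : comAlgType K) (S : lmodType K).

HB.instance Definition _ := GRing.Zmodule.copy (scalar_ext A S) (tensor S A).

Definition ext_scale (a : A) : scalar_ext A S -> scalar_ext A S :=
  tensor_lift (fun (x : S) (b : A) => tens x (a * b)).

Fact ext_scale_balanced (a : A) :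
  balanced (fun (x : S) (b : A) => tens x (a * b)).
Proof.
split=> [b x y|x b c|k x b].
- exact: tensDl.
- by rewrite mulrDr tensDr.
by rewrite tensZl -scalerAr tensZr.
Qed.

Fact ext_scale_tens a x b : ext_scale a (tens x b) = tens x (a * b).
Proof. exact: tensor_liftE (ext_scale_balanced a) x b. Qed.

Fact ext_scaleDr : right_distributive ext_scale +%R.
Proof. by move=> a; exact: (tensor_liftD (ext_scale_balanced a)). Qed.
Fact ext_scaleA a b t : ext_scale a (ext_scale b t) = ext_scale (a * b) t.
Proof.
elim/tens_ind: t => [x c|s t IHs IHt]; first by rewrite !ext_scale_tens mulrA.
by rewrite !ext_scaleDr IHs IHt.
Qed.
Fact ext_scale1 : left_id 1 ext_scale.
Proof.
elim/tens_ind=> [x c|s t IHs IHt]; first by rewrite ext_scale_tens mul1r.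
by rewrite !ext_scaleDr IHs IHt.
Qed.
Fact ext_scaleDl t : {morph ext_scale^~ t : a b / a + b}.
Proof.
move=> a b /=; elim/tens_ind: t => [x c|s t IHs IHt].
  by rewrite !ext_scale_tens mulrDl tensDr.
by rewrite !ext_scaleDr IHs IHt addrACA.
Qed.

HB.instance Definition _ := GRing.Zmodule_isLmodule.Build A (scalar_ext A S)
  ext_scaleA ext_scale1 ext_scaleDr ext_scaleDl.

Definition etens (x : S) (a : A) : scalar_ext A S := tens x a.

Lemma ext_scaleE (a : A) x b : a *: etens x b = etens x (a * b).
Proof. exact: ext_scale_tens. Qed.

(* The K-structure underlying the A-structure is that of the tensor product.  *)
Lemma ext_scaleK (k : K) (t : scalar_ext A S) :
  (k%:A : A) *: t = k *: (t : tensor S A) :> tensor S A.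
Proof.
elim/tens_ind: t => [x b|s t IHs IHt].
  by rewrite ext_scaleE /etens -scalerAl mul1r tensZr.
by rewrite (@scalerDr A (scalar_ext A S)) IHs IHt (@scalerDr K (tensor S A)).
Qed.

End ScalarExtension.

Section ActionLieRinehart.
Variables (K : fieldType) (A : comAlgType K) (P : leibnizPair A).
Local Notation S := (lp_lie P).
Local Notation beta := (@lp_beta _ _ P).
Local Notation T := (scalar_ext A S).
Implicit Types (x y z : S) (a b c : A).

Definition action_br1 x a y b : T :=
  etens (lie x y) (a * b) + etens y (a * beta x b) - etens x (b * beta y a).

Definition action_br (s t : T) : T :=
  tensor_lift (fun x a => tensor_lift (action_br1 x a) t) s.

Definition action_anchor (t : T) : Der A :=
  tensor_lift (fun x a => a *: beta x) t.

Let bD x y c : beta (x + y) c = beta x c + beta y c :> A.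
Proof. by rewrite (lie_homD (lp_betaP P)). Qed.
Let bZ (k : K) x c : beta (k *: x) c = k *: (beta x c : A) :> A.
Proof.
rewrite (lie_homZ (lp_betaP P)).
by change (k%:A * beta x c = k *: (beta x c : A) :> A); rewrite -scalerAl mul1r.
Qed.
Let b_lie x y c : beta (lie x y) c = beta x (beta y c) - beta y (beta x c) :> A.
Proof. by rewrite (lie_homE (lp_betaP P)). Qed.

Let eDl x y c : etens (x + y) c = etens x c + etens y c :> T.
Proof. exact: tensDl. Qed.
Let eDr x b c : etens x (b + c) = etens x b + etens x c :> T.
Proof. exact: tensDr. Qed.
Let eNl x c : etens (- x) c = - etens x c :> T.
Proof. exact: tensNl. Qed.
Let eNr x c : etens x (- c) = - etens x c :> T.
Proof. exact: tensNr. Qed.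
Let eZ (k : K) x c : etens (k *: x) c = etens x (k *: c) :> T.
Proof. by rewrite /etens tensZl tensZr. Qed.

Let br1_balanced x a : balanced (action_br1 x a : S -> A -> T).
Proof.
split=> [b y z|y b c|k y b]; rewrite /action_br1.
- rewrite lieDr !eDl bD mulrDr eDr opprD.
  by rewrite !addrA [LHS](ACl (1*3*5*2*4*6))%AC.
- rewrite derD !mulrDr mulrDl !eDr opprD.
  by rewrite !addrA [LHS](ACl (1*3*5*2*4*6))%AC.
by rewrite lieZr !eZ bZ derZ -!scalerAr -!scalerAl.
Qed.

Let br1_balanced_l t :
  balanced ((fun x a => tensor_lift (action_br1 x a) t) : S -> A -> T).
Proof.
have liftE x a := tensor_liftE (br1_balanced x a).
have liftD x a := tensor_liftD (br1_balanced x a).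
elim/tens_ind: t => [y b|s t [Dls Drs Zs] [Dlt Drt Zt]]; last first.
  split=> [a x z|x a c|k x a] /=; rewrite !liftD.
  - by rewrite Dls Dlt addrACA.
  - by rewrite Drs Drt addrACA.
  by rewrite Zs Zt.
split=> [a x z|x a c|k x a]; rewrite /= !liftE /action_br1.
- rewrite lieDl !eDl bD mulrDr eDr opprD.
  by rewrite !addrA [LHS](ACl (1*3*5*2*4*6))%AC.
- rewrite derD !mulrDr !mulrDl !eDr opprD.
  by rewrite !addrA [LHS](ACl (1*3*5*2*4*6))%AC.
by rewrite lieZl !eZ bZ derZ -!scalerAr -!scalerAl.
Qed.

Lemma action_br_tens x a y b :
  action_br (etens x a) (etens y b) =
  etens (lie x y) (a * b) + etens y (a * beta x b) - etens x (b * beta y a).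
Proof.
rewrite /action_br [LHS](tensor_liftE (br1_balanced_l _)).
exact: (tensor_liftE (br1_balanced x a)).
Qed.

Lemma action_brDl s s' t : action_br (s + s') t = action_br s t + action_br s' t.
Proof. exact: (tensor_liftD (br1_balanced_l t)). Qed.

Lemma action_brDr s t t' : action_br s (t + t') = action_br s t + action_br s t'.
Proof.
elim/tens_ind: s => [x a|s s' IHs IHs']; last first.
  by rewrite !action_brDl IHs IHs' addrACA.
rewrite /action_br !(tensor_liftE (br1_balanced_l _)).
exact: (tensor_liftD (br1_balanced x a)).
Qed.

Let anchor_balanced : balanced (fun x a => a *: beta x).
Proof.
split=> [a x y|x a b|k x a].
- by rewrite (lie_homD (lp_betaP P)) (@scalerDr A (Der A)).
- by rewrite scalerDl.
rewrite (lie_homZ (lp_betaP P)) restr_scaleE scalerA.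
by rewrite -scalerAr mulr1.
Qed.

Lemma action_anchor_tens x a : action_anchor (etens x a) = a *: beta x.
Proof. exact: (tensor_liftE anchor_balanced). Qed.

Lemma action_anchorD s t :
  action_anchor (s + t) = action_anchor s + action_anchor t.
Proof. exact: (tensor_liftD anchor_balanced). Qed.

Lemma action_anchorZ a t : action_anchor (a *: t) = a *: action_anchor t.
Proof.
elim/tens_ind: t => [x b|s t IHs IHt]; last first.
  by rewrite (@scalerDr A T) !action_anchorD IHs IHt scalerDr.
by rewrite ext_scaleE !action_anchor_tens scalerA.
Qed.

Fact action_anchor_linear : linear action_anchor.
Proof. by move=> a s t; rewrite action_anchorD action_anchorZ. Qed.

Lemma action_brZr s a t :
  action_br s (a *: t) = a *: action_br s t + (action_anchor s a : A) *: t.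
Proof.
elim/tens_ind: s => [x c|s s' IHs IHs']; last first.
  rewrite !action_brDl IHs IHs' action_anchorD derDl.
  by rewrite (@scalerDl A T) (@scalerDr A T) addrACA.
elim/tens_ind: t => [y b|t t' IHt IHt']; last first.
  by rewrite !(@scalerDr A T) !action_brDr IHt IHt' (@scalerDr A T) addrACA.
rewrite ext_scaleE !action_br_tens action_anchor_tens derZl.
rewrite !(@scalerDr A T) (@scalerN A T) !ext_scaleE derM mulrDr eDr.
rewrite (mulrCA c a b) (mulrCA c a) (mulrCA c b) (mulrA a b) (mulrC b).
by rewrite !addrA [LHS](ACl (1*2*4*3))%AC.
Qed.

Lemma action_brN s t : action_br s t = - action_br t s.
Proof.
elim/tens_ind: s => [x a|s s' IHs IHs']; last first.
  by rewrite action_brDl action_brDr IHs IHs' opprD.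
elim/tens_ind: t => [y b|t t' IHt IHt']; last first.
  by rewrite action_brDl action_brDr IHt IHt' opprD.
rewrite !action_br_tens lieN eNl mulrC !opprD opprK.
by rewrite [LHS](ACl (1*3*2))%AC.
Qed.

Lemma action_br_alt t : action_br t t = 0.
Proof.
elim/tens_ind: t => [x a|s t IHs IHt].
  by rewrite action_br_tens (lie_alt (lieP S)) /etens tens0l add0r subrr.
rewrite action_brDl !action_brDr IHs IHt addr0 add0r.
by rewrite [action_br s t]action_brN addNr.
Qed.

Lemma action_anchor_br s t c : action_anchor (action_br s t) c =
  action_anchor s (action_anchor t c) - action_anchor t (action_anchor s c) :> A.
Proof.
elim/tens_ind: s => [x a|s s' IHs IHs']; last first.
  rewrite action_brDl !action_anchorD !derDl IHs IHs' derD opprD.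
  exact: addrACA.
elim/tens_ind: t => [y b|t t' IHt IHt']; last first.
  rewrite action_brDr !action_anchorD !derDl IHt IHt' derD opprD.
  exact: addrACA.
have aN u d : action_anchor (- u) d = - (action_anchor u d) :> A.
  by rewrite -scaleN1r action_anchorZ derZl mulN1r.
rewrite action_br_tens !action_anchorD !derDl aN !action_anchor_tens !derZl.
rewrite b_lie !derM.
pose d z e : A := beta z e; rewrite -!/(d _ _).
ring.
Qed.

Let double_br x a y b z c :
  action_br (etens x a) (action_br (etens y b) (etens z c)) =
  etens (lie x (lie y z)) (a * (b * c)) +
  (etens (lie y z) (a * beta x (b * c)) + etens (lie z x) (- (a * (b * beta y c))) +
   etens (lie x y) (- (a * (c * beta z b)))) +
  (etens x (c * beta z b * beta y a - b * c * beta (lie y z) a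
            - b * beta y c * beta z a) +
   etens y (- (a * beta x (c * beta z b))) + etens z (a * beta x (b * beta y c))).
Proof.
rewrite action_br_tens !action_brDr -eNl !action_br_tens.
have bN w d : beta (- w) d = - (beta w d) :> A.
  by rewrite -scaleN1r bZ scaleN1r.
have lieNr : lie x (- y) = - lie x y by rewrite -scaleN1r lieZr scaleN1r.
rewrite lieNr !eNl bN mulrN !eNr opprK (lieN z x) eNl opprK.
rewrite !eDr !eNr !addrA.
by rewrite [LHS](ACl (1*2*4*7*9*3*6*8*5))%AC.
Qed.

Lemma action_br_jacobi s t r :
  action_br s (action_br t r) + action_br t (action_br r s) +
  action_br r (action_br s t) = 0.
Proof.
elim/tens_ind: s => [x a|s s' IHs IHs']; last first.
  rewrite !(action_brDl, action_brDr) !addrA [LHS](ACl ((1*3*5)*(2*4*6)))%AC /=.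
  by rewrite IHs IHs' addr0.
elim/tens_ind: t => [y b|s s' IHs IHs']; last first.
  rewrite !(action_brDl, action_brDr) !addrA [LHS](ACl ((1*3*5)*(2*4*6)))%AC /=.
  by rewrite IHs IHs' addr0.
elim/tens_ind: r => [z c|s s' IHs IHs']; last first.
  rewrite !(action_brDl, action_brDr) !addrA [LHS](ACl ((1*3*5)*(2*4*6)))%AC /=.
  by rewrite IHs IHs' addr0.
rewrite !double_br !addrA.
rewrite [LHS](ACl ((1*8*15)*(2*11*17)*(3*9*18)*(4*10*16)*(5*14*20)*
                   (6*12*21)*(7*13*19)))%AC /=.
rewrite (_ : b * (c * a) = a * (b * c)); last by ring.
rewrite (_ : c * (a * b) = a * (b * c)); last by ring.
rewrite -!eDl -!eDr (lie_jacobi (lieP S)) !b_lie !derM.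
pose d w e : A := beta w e; rewrite -!/(d _ _).
have e0 w e : e = 0 -> etens w e = 0 :> T by move=> ->; exact: tens0r.
rewrite [X in X + _ + _ + _ + _ + _ + _]tens0l.
by rewrite !e0 ?addr0 //; ring.
Qed.

Fact action_lie_bracket : @is_lie_bracket K (restr T) action_br.
Proof.
have brZr k s t : action_br s (k%:A *: t) = k%:A *: action_br s t.
  rewrite action_brZr.
  have -> : action_anchor s k%:A = 0 :> A.
    have d1 : action_anchor s 1 = 0 :> A.
      apply: (addrI (action_anchor s 1 : A)); rewrite addr0.
      by have := derM (action_anchor s) 1 1; rewrite !mul1r => <-.
    by rewrite derZ d1 scaler0.
  by rewrite (@scale0r A T) (@addr0 T).
split=> [t k s s'|s k t t'|s|s t r].
- rewrite action_brDl; congr (_ + _).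
  by rewrite action_brN brZr -(@scalerN A T) -action_brN.
- by rewrite action_brDr; congr (_ + _); exact: brZr.
- exact: action_br_alt.
exact: action_br_jacobi.
Qed.

Fact action_anchor_hom :
  is_lie_hom (action_anchor : LieAlg action_lie_bracket -> der_lie A).
Proof.
split=> [k s t|s t]; last by apply: der_eq => c; exact: action_anchor_br.
exact: action_anchor_linear.
Qed.

Definition action_lie_rinehart : lieRinehart A :=
  LieRinehart action_anchor_linear action_anchor_hom action_brZr.

End ActionLieRinehart.

(* Main.v *)
Require Import Defs.
From mathcomp Require Import all_boot all_order all_algebra.
From mathcomp Require Import boolp.

Set Implicit Arguments.
Unset Strict Implicit.
Unset Printing Implicit Defensive.

Import GRing.Theory.
Local Open Scope ring_scope.

(** Since [rho] is [K]-linear, [(x, a) |-> a *: rho x] is balanced over [K], so it factors through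
    the tensor product; as pure tensors span, the factorization is the only [K]-linear map with
    these values. All the axioms are additive in each tensor argument, so they need checking only on
    pure tensors. There the Leibniz rule is that of [rho] multiplied by a scalar. For the bracket
    ([action_rep_br]), moving [b] past [rho x] yields the term [a * beta x b] and moving [a] past
    [rho y] yields [b * beta y a]: exactly the two correction terms in the action bracket. *)

Section ActionRepresentation.
Variables (K : fieldType) (A : comAlgType K) (P : leibnizPair A).
Variables (M : lmodType A) (rho : lp_lie P -> gl M).
Hypothesis rho_adm : admissible_rep rho.
Local Notation T := (scalar_ext A (lp_lie P)).

Definition action_rep (t : T) : gl M := tensor_lift (fun x a => a *: rho x) t.

Lemma action_rep_balanced : balanced (fun x (a : A) => a *: rho x).
Proof.
have rho_hom := admissible_hom rho_adm.
split=> [a x y|x a b|k x a].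
- by rewrite (lie_homD rho_hom) (@scalerDr A (gl M)).
- by rewrite scalerDl.
by rewrite (lie_homZ rho_hom) restr_scaleE scalerA -scalerAr mulr1.
Qed.

Lemma action_rep_etens x a : action_rep (etens x a) = a *: rho x.
Proof. exact: (tensor_liftE action_rep_balanced). Qed.

Lemma action_repD s t : action_rep (s + t) = action_rep s + action_rep t.
Proof. exact: (tensor_liftD action_rep_balanced). Qed.

Lemma action_repZ a t : action_rep (a *: t) = a *: action_rep t.
Proof.
elim/tens_ind: t => [x b|s t IHs IHt]; last first.
  by rewrite (@scalerDr A T) !action_repD IHs IHt scalerDr.
by rewrite ext_scaleE !action_rep_etens scalerA.
Qed.

Lemma action_repN t : action_rep (- t) = - action_rep t.
Proof. by rewrite -(@scaleN1r A T) action_repZ scaleN1r. Qed.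

Lemma action_rep_linear : linear action_rep.
Proof. by move=> a s t; rewrite action_repD action_repZ. Qed.

(** The prescription on pure tensors determines a map only among [K]-linear ones, so linearity is
    also needed for the original [K]-structure of the tensor product; [ext_scaleK] identifies it
    with the restriction of the [A]-structure. *)
Lemma action_rep_klinear :
  linear (action_rep : tensor (lp_lie P) A -> restr (gl M)).
Proof.
move=> k s t; rewrite -[k *: s](@ext_scaleK K A).
exact: action_rep_linear.
Qed.

Lemma action_rep_leibniz t (a : A) (m : M) :
  action_rep t (a *: m) =
  a *: action_rep t m + (action_anchor t a : A) *: m.
Proof.
elim/tens_ind: t => [x b|s t IHs IHt]; last first.
  rewrite action_repD action_anchorD !glDl derDl IHs IHt.
  by rewrite scalerDr scalerDl addrACA.
rewrite action_rep_etens action_anchor_tens !glZl derZl.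
by rewrite (admissible_leibniz rho_adm) scalerDr !scalerA [b * a]mulrC.
Qed.

Lemma action_rep_br s t m :
  action_rep (action_br s t) m =
  action_rep s (action_rep t m) - action_rep t (action_rep s m).
Proof.
elim/tens_ind: s => [x a|s s' IHs IHs']; last first.
  by rewrite action_brDl !action_repD !glDl IHs IHs' glD opprD addrACA.
elim/tens_ind: t => [y b|t t' IHt IHt']; last first.
  by rewrite action_brDr !action_repD !glDl IHt IHt' glD opprD addrACA.
rewrite action_br_tens !action_repD action_repN !action_rep_etens.
rewrite (lie_homE (admissible_hom rho_adm)).
(* Evaluation at [m] turns the bracket of [gl_lie M] into a commutator. Expanding the right-hand
   side by admissibility then leaves only a reordering of terms. *)
change ((a * b) *: (rho x (rho y m) - rho y (rho x m)) +
    (a * (lp_beta x b : A)) *: rho y m - (b * (lp_beta y a : A)) *: rho x m =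
  a *: rho x (b *: rho y m) - b *: rho y (a *: rho x m) :> M).
rewrite !(admissible_leibniz rho_adm) scalerBr !scalerDr !scalerA [b * a]mulrC.
by rewrite opprD !addrA [LHS](ACl (1*3*2*4))%AC.
Qed.

Lemma action_rep_lr_rep :
  lr_rep (action_rep : action_lie_rinehart P -> gl M).
Proof.
split; [exact: action_rep_linear | split | exact: action_rep_leibniz].
(* On both sides [k] acts as [k%:A], so this is [A]-linearity at the scalar [k%:A]. *)
- by move=> k s t; exact: action_rep_linear.
by move=> s t; apply: gl_eq => m; exact: action_rep_br.
Qed.

End ActionRepresentation.

(** Pure tensors generate the tensor product additively, so additivity, the case of scalar [1], is
    enough. *)
Lemma tensor_linear_ext (K : fieldType) (U V W : lmodType K)
    (f g : tensor U V -> W) :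
  linear f -> linear g -> (forall u v, f (tens u v) = g (tens u v)) -> f = g.
Proof.
move=> fl gl fg; apply/funext; elim/tens_ind=> // s t IHs IHt.
have := fl 1 s t; have := gl 1 s t.
by rewrite !scale1r => -> ->; rewrite IHs IHt.
Qed.

Theorem proposition3p33 (K : closedFieldType) (charK : [pchar K] =i pred0)
    (A : comAlgType K) (P : leibnizPair A) (M : lmodType A)
    (rho : lp_lie P -> gl M) (rho_adm : admissible_rep rho) :
  exists rhobar : action_lie_rinehart P -> gl M,
    unique (fun f : action_lie_rinehart P -> gl M =>
              linear (f : tensor (lp_lie P) A -> restr (gl M)) /\
              forall (x : lp_lie P) (a : A), f (etens x a) = a *: rho x)
           rhobar /\
    lr_rep rhobar.
Proof.
exists (action_rep rho); split; last exact: action_rep_lr_rep.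
split; first by split; [exact: action_rep_klinear|exact: action_rep_etens].
move=> f [fl fE].
(* The target is [restr (gl M)] because the competitor [f] is only assumed [K]-linear. *)
apply: (@tensor_linear_ext K (lp_lie P) A (restr (gl M))) => // [|x a].
  exact: action_rep_klinear.
by rewrite [LHS](action_rep_etens rho_adm) -fE.
Qed.
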